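(* Let $\mathsf{G}=(N,B,w)$ be a strongly connected weighted digraph with node set $N=\{1,\dots,n\}$, constant branch weights and Laplacian $\mathbf{L}$, and let $\boldsymbol{q}\in\mathbb{R}^n_{>0}$ be a left eigenvector of $\mathbf{L}$ such that $\boldsymbol{q}^\top\mathbf{L}=\boldsymbol{0}$. Let $\hat{\boldsymbol{q}}:=\boldsymbol{q}/|\boldsymbol{q}|_1$. Then the entropic consensus dynamics $$\dot{x}_i=-\sum_{j\in N_i^+}w_{ij}\,x_i\ln\frac{x_i}{x_j},\qquad i\in N,$$ starting at any $\boldsymbol{x}(0)\in\mathbb{R}^n_{>0}$ asymptotically (as $t\to\infty$) reaches a fixed point $\bar{x}\boldsymbol{1}$, with $$\bar{x}=\prod_{i=1}^n x_i(0)^{\hat{q}_i},$$ i.e. $\bar{x}$ is the weighted geometric mean of the initial condition with weights $\hat{q}_i$.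
   Context: A weighted digraph $\mathsf{G}=(N,B,w)$ has nodes $N=\{1,\dots,n\}$, a set of branches $B\subseteq N\times N$ whose elements are ordered pairs $(j,i)$ indicating a branch from node $j$ to node $i$, and a weighting $w:B\to\mathbb{R}_{>0}$ with $w_{ij}:=w((j,i))$. There are no self-loops, and the weights are constant in time. The in-neighborhood of node $i$ is $N_i^+:=\{j\in N:(j,i)\in B\}$. The adjacency matrix $\mathbf{W}$ has $[\mathbf{W}]_{ij}=w_{ij}$ if $(j,i)\in B$ and $0$ otherwise. The degree is $d_i:=\sum_{j\in N_i^+}w_{ij}$, $\mathbf{D}:=\mathrm{diag}\{d_1,\dots,d_n\}$, and the Laplacian is $\mathbf{L}:=\mathbf{D}-\mathbf{W}$. Strongly connected means there is a directed path from every node to every other node. $\boldsymbol{1}$ is the all-ones vector and $|\cdot|_1$ is the 1-norm; the vector $\hat{\boldsymbol{q}}$ is called the Perron vector of $\mathbf{L}$. *)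

(* Defs.v *)
From HB Require Import structures.
From mathcomp Require Import all_boot all_order all_algebra.
From mathcomp Require Import all_classical all_reals all_analysis.

Set Implicit Arguments.
Unset Strict Implicit.
Unset Printing Implicit Defensive.

Import Order.TTheory GRing.Theory Num.Theory.
Import numFieldNormedType.Exports.

Local Open Scope classical_set_scope.
Local Open Scope ring_scope.

(* The pair (j, i) is the branch from j to i. [bweight] is total for
   convenience: its values outside [branches] are unconstrained and every
   definition below only reads it on [branches]. *)
Record wdigraph (R : realType) (n : nat) := WDigraph {
  branches : {set 'I_n * 'I_n};
  bweight : 'I_n * 'I_n -> R;
  no_self_loop : forall i : 'I_n, (i, i) \notin branches;
  bweight_gt0 : forall b, b \in branches -> 0 < bweight b }.

Section WeightedDigraph.
Context {R : realType} {n : nat}.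
Implicit Types (G : wdigraph R n) (i j : 'I_n).

(* Note the index order: [w_ G i j] is the weight of the branch from j to i. *)
Definition w_ G i j : R := bweight G (j, i).

Definition in_nbhd G i : {set 'I_n} := [set j | (j, i) \in branches G]%SET.

Definition strongly_connected G : Prop :=
  forall i j, connect [rel u v | (u, v) \in branches G] i j.

Definition adjacency G : 'M[R]_n :=
  \matrix_(i, j) if (j, i) \in branches G then w_ G i j else 0.

Definition degree G i : R := \sum_(j in in_nbhd G i) w_ G i j.

Definition laplacian G : 'M[R]_n :=
  diag_mx (\row_i degree G i) - adjacency G.

Definition positive_vector (v : 'cV[R]_n) : Prop := forall i, 0 < v i 0.

(* The canonical norm on matrices is the sup norm, hence this definition. *)
Definition norm1 (v : 'cV[R]_n) : R := \sum_i `|v i 0|.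

Definition entropic_field G (x : 'cV[R]_n) : 'cV[R]_n :=
  \col_i - \sum_(j in in_nbhd G i) w_ G i j * x i 0 * ln (x i 0 / x j 0).

Definition fixed_point G (p : 'cV[R]_n) : Prop :=
  positive_vector p /\ entropic_field G p = 0.

(* The state space is the open positive orthant, where the logarithms make
   sense. The values of [x] at negative times are irrelevant; at t = 0 only
   continuity from the right is required, and the one-sided differential
   equation there follows by the mean value theorem. *)
Definition solution G (x0 : 'cV[R]_n) (x : R -> 'cV[R]_n) : Prop :=
  [/\ x 0 = x0,
      forall t, 0 <= t -> positive_vector (x t),
      {within [set t : R | 0 <= t], continuous x} &
      forall t : R, 0 < t -> is_derive t (1 : R) x (entropic_field G (x t))].

End WeightedDigraph.

(* Main.v *)
Require Import Defs.
From HB Require Import structures.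
From mathcomp Require Import all_boot all_order all_algebra.
From mathcomp Require Import all_classical all_reals all_analysis.
From mathcomp Require Import ring lra.

Set Implicit Arguments.
Unset Strict Implicit.
Unset Printing Implicit Defensive.

Import Order.TTheory GRing.Theory Num.Theory.
Import numFieldNormedType.Exports.

Local Open Scope classical_set_scope.
Local Open Scope ring_scope.

(* In logarithmic coordinates y = ln x the entropic dynamics is the linear
   consensus dynamics y' = - L y, so a global solution is given componentwise
   by the exponential series. For any solution, q^T L = 0 makes the weighted
   sum of the y_i constant, and the weighted variance V of y around its mean
   satisfies V' = - E, where E is the Dirichlet form
   sum_ij q_i w_ij (y_i - y_j)^2. Strong connectivity gives a Poincare
   inequality c V <= E, hence V decays like exp(- c t) and every y_i tends to
   the weighted mean of the ln x_i(0). *)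

(** * Laplacian, Dirichlet form and Poincare inequality *)

Section Dirichlet.
Context {R : realType} {n : nat} (G : wdigraph R n).
Implicit Types (q : 'cV[R]_n) (y : 'I_n -> R).

(** This is [- L y] in difference form, which makes the invariance under adding a constant to [y]
    visible. *)
Definition log_field y (i : 'I_n) : R :=
  - \sum_j adjacency G i j * (y i - y j).

Definition dirichlet q y : R :=
  \sum_i \sum_j q i 0 * adjacency G i j * (y i - y j) ^+ 2.

Lemma sum_in_nbhd i (f : 'I_n -> R) :
  \sum_(j in in_nbhd G i) w_ G i j * f j = \sum_j adjacency G i j * f j.
Proof.
rewrite big_mkcond; apply: eq_bigr => j _.
by rewrite inE mxE; case: ifP => // _; rewrite mul0r.
Qed.

Lemma adjacency_ge0 i j : 0 <= adjacency G i j.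
Proof. by rewrite mxE; case: ifPn => // /bweight_gt0/ltW. Qed.

Lemma laplacian_mulE (v : 'cV[R]_n) i :
  (- laplacian G *m v) i 0 = log_field (fun j => v j 0) i.
Proof.
rewrite mulNmx mxE mulmxBl mul_diag_mx !mxE; congr (- _).
under [RHS]eq_bigr do rewrite mulrBr.
rewrite sumrB -mulr_suml; congr (_ * _ - _).
rewrite /degree big_mkcond; apply: eq_bigr => j _.
by rewrite inE mxE.
Qed.

Lemma entropic_fieldE (x : 'cV[R]_n) i : positive_vector x ->
  entropic_field G x i 0 = x i 0 * log_field (fun j => ln (x j 0)) i.
Proof.
move=> x0; rewrite mxE mulrN mulr_sumr; congr (- _).
under eq_bigr do rewrite -mulrA.
rewrite sum_in_nbhd; apply: eq_bigr => j _.
by rewrite mulrCA ln_div// posrE.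
Qed.

(** The double sum is [q^T L y]; bracketing it as [(q^T L) y] makes it vanish. *)
Lemma left_null_sum_diff q y : q^T *m laplacian G = 0 ->
  \sum_i \sum_j q i 0 * adjacency G i j * (y i - y j) = 0.
Proof.
move=> qL; pose v := \col_i y i.
transitivity ((q^T *m (laplacian G *m v)) 0 0); last first.
  by rewrite mulmxA qL mul0mx mxE.
rewrite mxE; apply: eq_bigr => i _.
have := laplacian_mulE v i; rewrite mulNmx mxE => /oppr_inj ->.
by rewrite mxE mulr_sumr; apply: eq_bigr => j _; rewrite !mxE mulrA.
Qed.

Lemma sum_log_field q y : q^T *m laplacian G = 0 ->
  \sum_i q i 0 * log_field y i = 0.
Proof.
move=> qL; under eq_bigr do rewrite mulrN mulr_sumr.
rewrite sumrN; under eq_bigr do under eq_bigr do rewrite mulrA.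
by rewrite left_null_sum_diff// oppr0.
Qed.

(** With [a = y i - m] and [b = y j - m], one has [2 a (a - b) = (a - b)^2 + (a^2 - b^2)]; the terms
    [a^2 - b^2] cancel in the sum by [left_null_sum_diff] applied to the squares. The left side is
    the time derivative of the variance. *)
Lemma dirichletE q y m : q^T *m laplacian G = 0 ->
  \sum_i q i 0 * ((y i - m) * log_field y i *+ 2) = - dirichlet q y.
Proof.
move=> qL; apply/eqP; rewrite -addr_eq0; apply/eqP.
have /(congr1 -%R) := left_null_sum_diff (fun i => (y i - m) ^+ 2) qL.
rewrite oppr0; apply: etrans; rewrite /dirichlet -big_split/= -[RHS]sumrN.
apply: eq_bigr => i _.
rewrite mulrN mulNrn mulrN mulr_sumr -sumrMnl mulr_sumr -!sumrN -big_split/=.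
by apply: eq_bigr => j _; ring.
Qed.

Lemma dirichlet_ge0 q y : positive_vector q -> 0 <= dirichlet q y.
Proof.
move=> q0; do 2![apply: sumr_ge0 => ? _].
by rewrite mulr_ge0 ?sqr_ge0// mulr_ge0 ?adjacency_ge0//; exact/ltW/q0.
Qed.

(** The square, times its positive coefficient, is a single term of a sum of nonnegative terms. *)
Lemma dirichlet_branch q i j : positive_vector q -> (j, i) \in branches G ->
  exists2 C, 0 <= C & forall y, (y i - y j) ^+ 2 <= C * dirichlet q y.
Proof.
move=> q0 ji; have c0 : 0 < q i 0 * adjacency G i j.
  by rewrite mulr_gt0// mxE ji bweight_gt0.
exists (q i 0 * adjacency G i j)^-1 => [|y]; first by rewrite invr_ge0 ltW.
rewrite mulrC ler_pdivlMr// mulrC /dirichlet.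
have ge0 k l : 0 <= q k 0 * adjacency G k l * (y k - y l) ^+ 2.
  by rewrite mulr_ge0 ?sqr_ge0// mulr_ge0 ?adjacency_ge0//; exact/ltW/q0.
rewrite (bigD1 i)//= (bigD1 j)//= -addrA lerDl addr_ge0//.
  exact: sumr_ge0.
by apply: sumr_ge0 => k _; exact: sumr_ge0.
Qed.

(** Induction along a path from [i] to [j], splitting off the first branch and using
    [(a + b)^2 <= 2 a^2 + 2 b^2]. *)
Lemma dirichlet_connect q i j : positive_vector q ->
    connect [rel u v | (u, v) \in branches G] i j ->
  exists2 C, 0 <= C & forall y, (y i - y j) ^+ 2 <= C * dirichlet q y.
Proof.
move=> q0 /connectP[p]; elim: p i => [|k p IH] i /=.
  by move=> _ ->; exists 0 => // y; rewrite subrr expr0n mul0r.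
move=> /andP[ik kp] jE.
have [C C0 CE] := IH k kp jE; have [D D0 DE] := dirichlet_branch q0 ik.
exists ((C + D) *+ 2) => [|y]; first by rewrite mulrn_wge0// addr_ge0.
have := CE y; have := DE y.
(* Nonnegativity of [(a - b)^2] is what bounds [(a + b)^2] by [2 a^2 + 2 b^2]. The branch goes from
   [i] to [k], so its bound is on [y k - y i] and the sign has to be flipped. *)
have := sqr_ge0 ((y i - y k) - (y k - y j)).
rewrite -(sqrrN (y k - y i)) opprB mulrnAl mulrDl.
move=> *; nra.
Qed.

Lemma dirichlet_dist q : positive_vector q -> strongly_connected G ->
  exists2 C, 0 <= C & forall y i j, (y i - y j) ^+ 2 <= C * dirichlet q y.
Proof.
move=> q0 sc.
have /choice[C CP] (ij : 'I_n * 'I_n) : exists C, 0 <= C /\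
    forall y, (y ij.1 - y ij.2) ^+ 2 <= C * dirichlet q y.
  by have [C] := dirichlet_connect q0 (sc ij.1 ij.2); exists C.
exists (\sum_ij C ij) => [|y i j].
  by apply: sumr_ge0 => ij _; have [] := CP ij.
rewrite (le_trans ((CP (i, j)).2 y))// ler_wpM2r ?dirichlet_ge0//.
by rewrite (bigD1 (i, j))//= lerDl sumr_ge0// => ij _; have [] := CP ij.
Qed.

(** Replacing the mean [m] by the value at one node [k] can only increase the variance, and then
    [dirichlet_dist] bounds every term. *)
Lemma poincare q : (0 < n)%N -> positive_vector q -> strongly_connected G ->
  exists2 c, 0 < c & forall y m,
    \sum_i q i 0 * y i = m * \sum_i q i 0 ->
    c * \sum_i q i 0 * (y i - m) ^+ 2 <= dirichlet q y.
Proof.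
move=> n_gt0 q0 sc; have [C C0 CE] := dirichlet_dist q0 sc.
pose k := Ordinal n_gt0; pose Q := \sum_i q i 0.
have Q0 : 0 <= Q by apply: sumr_ge0 => i _; exact/ltW/q0.
(* The added [1] keeps the constant invertible when [C = 0]. *)
have QC : 0 < Q * C + 1 by rewrite ltr_wpDl ?mulr_ge0.
exists (Q * C + 1)^-1 => [|y m ym]; first by rewrite invr_gt0.
rewrite mulrC ler_pdivrMr// mulrC mulrDl mul1r.
rewrite (@le_trans _ _ (\sum_i q i 0 * (y i - y k) ^+ 2))//.
  (* The weighted mean minimises the weighted sum of squared deviations. *)
  rewrite -subr_ge0 -sumrB.
  have -> : \sum_i (q i 0 * (y i - y k) ^+ 2 - q i 0 * (y i - m) ^+ 2) =
      (m - y k) * \sum_i (q i 0 * y i *+ 2 - (m + y k) * q i 0).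
    by rewrite mulr_sumr; apply: eq_bigr => i _; ring.
  rewrite sumrB sumrMnl ym -mulr_sumr -/Q.
  have -> : (m - y k) * (m * Q *+ 2 - (m + y k) * Q) = (m - y k) ^+ 2 * Q.
    by ring.
  by rewrite mulr_ge0 ?sqr_ge0.
rewrite ler_wpDr ?dirichlet_ge0// -mulrA mulr_suml ler_sum// => i _.
by rewrite ler_wpM2l//; exact/ltW/q0.
Qed.

End Dirichlet.

(** * Exponential series and linear differential equations *)

Lemma geometric_cvg_pseries {R : realType} (C K : R) (v : R^nat) (t : R) :
  0 <= C -> 0 <= K -> (forall k, `|v k| <= C * K ^+ k) ->
  cvgn (pseries (fun k => v k / k`!%:R) t).
Proof.
move=> C0 K0 vCK; apply: normed_cvg.
apply: (@series_le_cvg _ _ (C *: exp_coeff (K * `|t|))) => [k|k|k|].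
- exact: normr_ge0.
- by rewrite mulr_ge0// exp_coeff_ge0// mulr_ge0.
- rewrite fctE/= /exp_coeff/= !normrM normfV normr_nat normrX exprMn.
  by rewrite /GRing.scale/= mulrAC !mulrA ler_wpM2r// ler_wpM2r// exprn_ge0.
- exact/is_cvg_seriesZ/is_cvg_series_exp_coeff.
Qed.

(** Formal differentiation of the series shifts [v] by one, which preserves the geometric bound with
    [C * K] in place of [C]; so the series and its first two formal derivatives converge
    everywhere. *)
Lemma is_derive_exp_series {R : realType} (C K : R) (v : R^nat) (t : R) :
  0 <= C -> 0 <= K -> (forall k, `|v k| <= C * K ^+ k) ->
  is_derive t (1 : R)
    (fun s => limn (pseries (fun k => v k / k`!%:R) s))
    (limn (pseries (fun k => v k.+1 / k`!%:R) t)).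
Proof.
move=> C0 K0 vCK.
have diffsE (u : R^nat) : pseries_diffs (fun k => u k / k`!%:R) =
    (fun k => u k.+1 / k`!%:R).
  apply/funext => k; rewrite /pseries_diffs factS natrM invfM mulrCA.
  by rewrite mulVKf ?pnatr_eq0.
have shift_bound (c : R) (u : R^nat) : (forall k, `|u k| <= c * K ^+ k) ->
    forall k, `|u k.+1| <= (c * K) * K ^+ k.
  by move=> uc k; rewrite -mulrA -exprS.
(* Any point of modulus greater than that of [t] would serve here. *)
rewrite -diffsE; apply: (@pseries_snd_diffs _ _ (`|t| + 1)).
- exact: geometric_cvg_pseries vCK.
- rewrite diffsE; apply: (@geometric_cvg_pseries _ (C * K) K) => //.
    exact: mulr_ge0.
  exact: shift_bound.
- rewrite diffsE (diffsE (fun k => v k.+1)).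
  apply: (@geometric_cvg_pseries _ (C * K * K) K) => //.
    by rewrite !mulr_ge0.
  apply: (shift_bound _ (fun k => v k.+1)).
  exact: shift_bound.
- by rewrite [ltRHS]ger0_norm ?ltrDl// addr_ge0.
Qed.

Lemma linear_ode {R : realType} {n : nat} (M : 'M[R]_n) (y0 : 'cV[R]_n) :
  exists y : R -> 'cV[R]_n, y 0 = y0 /\
    forall t i, is_derive t (1 : R) (fun s => y s i 0) ((M *m y t) i 0).
Proof.
pose v k := iter k (mulmx M) y0.
(* [v k] is [M^k y0]. [K] dominates every absolute row sum of [M], so each product with [M] costs at
   most a factor [K] in the sup norm. *)
pose C := \sum_i `|y0 i 0|; pose K := \sum_i \sum_j `|M i j|.
have C0 : 0 <= C by apply: sumr_ge0.
have K0 : 0 <= K by do 2![apply: sumr_ge0 => ? _].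
have vCK k : forall i, `|v k i 0| <= C * K ^+ k.
  elim: k => [|k IH] i.
    by rewrite mulr1 /C (bigD1 i)//= lerDl sumr_ge0.
  rewrite exprS mulrCA -/v /v iterS -/(v k) mxE.
  rewrite (le_trans (ler_norm_sum _ _ _))//.
  rewrite (@le_trans _ _ (\sum_j `|M i j| * (C * K ^+ k)))//.
    by apply: ler_sum => j _; rewrite normrM ler_wpM2l.
  rewrite -mulr_suml ler_wpM2r ?mulr_ge0 ?exprn_ge0//.
  rewrite /K [leRHS](bigD1 i)//= lerDl.
  by do 2![apply: sumr_ge0 => ? _].
pose y t := \col_i limn (pseries (fun k => v k i 0 / k`!%:R) t).
exists y; split.
  apply/colP => i; rewrite mxE; apply: cvg_lim => //.
  (* The partial sum of index 0 is empty; from index 1 on, the partial sums at time 0 all equal the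
     constant term. *)
  rewrite -cvg_shiftS/=.
  have -> : (fun k => pseries (fun k => v k i 0 / k`!%:R) 0 k.+1) =
      cst (y0 i 0).
    apply/funext => k; rewrite /pseries /series/= big_nat_recl//= big1.
      by rewrite expr0 mulr1 divr1 addr0.
    by move=> j _; rewrite expr0n mulr0.
  exact: cvg_cst.
move=> t i.
have -> : (M *m y t) i 0 = limn (pseries (fun k => v k.+1 i 0 / k`!%:R) t).
  rewrite mxE; apply/esym/cvg_lim => //.
  have -> : pseries (fun k => v k.+1 i 0 / k`!%:R) t =
      (fun N => \sum_j M i j * pseries (fun k => v k j 0 / k`!%:R) t N).
    apply/funext => N; rewrite /pseries /series/=.
    under [RHS]eq_bigr do rewrite mulr_sumr.
    rewrite exchange_big/=; apply: eq_bigr => k _.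
    rewrite mxE -mulrA mulr_suml; apply: eq_bigr => j _.
    by rewrite !mulrA.
  apply: cvg_big => [|j _]; first exact: add_continuous.
  rewrite mxE; apply: cvgMl_tmp.
  by apply: (@geometric_cvg_pseries _ C K (fun k => v k j 0)).
under eq_fun do rewrite mxE.
by apply: (@is_derive_exp_series _ C K (fun k => v k i 0)).
Qed.

(** * Calculus of matrix-valued functions and weighted sums *)

Lemma is_derive_mx {R : realType} {m n : nat} (M : R -> 'M[R]_(m, n)) t dM :
  is_derive t (1 : R) M dM <->
  forall i j, is_derive t (1 : R) (fun s => M s i j) (dM i j).
Proof.
split=> [[Mt <-] i j|MdM].
  split; first by move/derivable_mxP : Mt.
  by rewrite derive_mx// mxE.
have Mt : derivable M t 1 by apply/derivable_mxP => i j; have [] := MdM i j.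
split => //; rewrite derive_mx//; apply/matrixP => i j; rewrite mxE.
by have [] := MdM i j.
Qed.

Lemma cvg_mx {R : realType} {m n : nat} {T : Type} {F : set_system T}
    {FF : Filter F} (M : T -> 'M[R]_(m, n)) (l : 'M[R]_(m, n)) :
  (forall i j, M t i j @[t --> F] --> l i j) -> M t @[t --> F] --> l.
Proof.
move=> Ml; apply/cvgrPdist_le => /= e e0; near=> t.
rewrite /Num.Def.normr/= mx_normrE (bigmax_le _ (ltW e0))//= => ij _.
rewrite !mxE; move: ij; near: t; apply: filter_forall => /= ij.
by move/cvgrPdist_le : (Ml ij.1 ij.2) => /(_ e e0).
Unshelve. all: by end_near. Qed.

Lemma sum_positive_vector {R : realType} {n : nat} (q : 'cV[R]_n) :
  (0 < n)%N -> positive_vector q -> 0 < \sum_i q i 0.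
Proof.
move=> n_gt0 q_gt0; rewrite (bigD1 (Ordinal n_gt0))//= ltr_pwDl//.
by apply: sumr_ge0 => i _; exact/ltW/q_gt0.
Qed.

(** The mean value theorem on [[0, t]] asks for a derivative only in the interior, which matches
    what [solution] grants at time 0. *)
Lemma is_derive0_constant {R : realType} (f : R -> R) :
  {within `[0, +oo[, continuous f} ->
  (forall t : R, 0 < t -> is_derive t (1 : R) f 0) ->
  forall t : R, 0 <= t -> f t = f 0.
Proof.
move=> cf df t t0.
have [||c _] := @MVT_segment _ f (cst 0) 0 t t0.
- by move=> s; rewrite in_itv/= => /andP[s0 _]; exact: df.
- by apply: continuous_subspaceW cf; exact/subset_itvl.
- by rewrite mul0r => /eqP; rewrite subr_eq0 => /eqP.
Qed.

Lemma is_derive_weighted_sum {R : realType} {n : nat} (a : 'I_n -> R)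
    (f : 'I_n -> R -> R) t df :
  (forall i, is_derive t (1 : R) (f i) (df i)) ->
  is_derive t (1 : R) (fun s => \sum_i a i * f i s) (\sum_i a i * df i).
Proof.
move=> fdf; rewrite [X in is_derive _ _ X](_ : _ = \sum_i (a i \*: f i)).
  by apply: is_derive_sum => i; exact: is_deriveZ.
by apply/funext => s; rewrite fct_sumE.
Qed.

Lemma within_continuous_sum {R : realType} {n : nat} (A : set R)
    (f : 'I_n -> R -> R) :
  (forall i, {within A, continuous (f i)}) ->
  {within A, continuous (fun t => \sum_i f i t)}.
Proof.
move=> cf; apply: continuous_big => [|i _]; last exact: cf.
exact: add_continuous.
Qed.

(** * Existence of solutions and logarithmic coordinates *)

Section Trajectory.
Context {R : realType} {n : nat} (G : wdigraph R n).
Implicit Types x : R -> 'cV[R]_n.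

Lemma solution_exists (x0 : 'cV[R]_n) : positive_vector x0 ->
  exists x, solution G x0 x.
Proof.
move=> x0_gt0.
have [y [y0 dy]] := linear_ode (- laplacian G) (\col_i ln (x0 i 0)).
pose x t := \col_i expR (y t i 0); exists x.
have x_gt0 t : positive_vector (x t) by move=> i; rewrite mxE expR_gt0.
have dx t : is_derive t (1 : R) x (entropic_field G (x t)).
  apply/is_derive_mx => i j; rewrite (ord1 j) entropic_fieldE//.
  rewrite [X in is_derive _ _ X](_ : _ = expR \o (fun s => y s i 0));
      last first.
    by apply/funext => s; rewrite mxE.
  rewrite (_ : log_field _ _ _ = (- laplacian G *m y t) i 0); last first.
    rewrite laplacian_mulE; congr (log_field G _ i).
    by apply/funext => k; rewrite mxE expRK.
  by rewrite mxE; apply: is_derive1_comp; exact: dy.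
split=> //.
  by apply/colP => i; rewrite mxE y0 mxE lnK// posrE.
apply: continuous_subspaceT => t; apply: differentiable_continuous.
by apply/derivable1_diffP; have [] := dx t.
Qed.

Lemma solution_ln (x0 : 'cV[R]_n) x i : solution G x0 x ->
  {within `[0, +oo[, continuous (fun t => ln (x t i 0))} /\
  forall t : R, 0 < t -> is_derive t (1 : R) (fun t => ln (x t i 0))
    (log_field G (fun j => ln (x t j 0)) i).
Proof.
move=> [_ x_gt0 cx dx]; split=> [|t t0].
  have sE : `[0%R, +oo[%classic = [set t : R | 0 <= t].
    by apply/seteqP; split => t /=; rewrite in_itv/= andbT.
  rewrite sE.
  have cxi : {within [set t : R | 0 <= t], continuous (fun t => x t i 0)}.
    have := @within_continuous_comp _ _ _ _ _ (fun v : 'cV[R]_n => v i 0) _ cx.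
    by apply=> v _; exact: coord_continuous.
  have := @within_continuous_comp _ _ _ _ _ (@ln R) _ cxi.
  apply=> _ /set_mem[t /= t0 <-].
  by apply: continuous_ln; exact: x_gt0.
have /is_derive_mx/(_ i 0) := dx _ t0; rewrite entropic_fieldE; last first.
  exact/x_gt0/ltW.
move=> dxi; have xi0 := x_gt0 _ (ltW t0) i.
have /= := is_derive1_comp (is_derive1_ln xi0) dxi.
by rewrite mulKf ?gt_eqF.
Qed.

(** * Conserved mean, decay of the variance and consensus *)

Section Convergence.
Context {q x0 : 'cV[R]_n} {x : R -> 'cV[R]_n}.
Hypotheses (n_gt0 : (0 < n)%N) (G_sc : strongly_connected G)
  (q_gt0 : positive_vector q) (qL : q^T *m laplacian G = 0)
  (xs : solution G x0 x).

Let y i t := ln (x t i 0).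

Lemma solution_invariant t : 0 <= t ->
  \sum_i q i 0 * y i t = \sum_i q i 0 * ln (x0 i 0).
Proof.
move=> t0; have [xE _ _ _] := xs.
rewrite (_ : \sum_i q i 0 * ln (x0 i 0) = \sum_i q i 0 * y i 0); last first.
  by rewrite /y xE.
apply: (@is_derive0_constant _ (fun t => \sum_i q i 0 * y i t)) => // [|s s0].
  apply: within_continuous_sum => i s; apply: cvgMl_tmp.
  exact: (solution_ln i xs).1.
apply: is_derive_eq (sum_log_field (fun j => y j s) qL).
by apply: is_derive_weighted_sum => i; exact: (solution_ln i xs).2.
Qed.

Let m := (\sum_i q i 0 * ln (x0 i 0)) / \sum_i q i 0.
Let V t := \sum_i q i 0 * (y i t - m) ^+ 2.

(** Gronwall argument with integrating factor [expR (c * t)]: the product with [V] has derivative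
    [expR (c * t) * (c V - E)], which is nonpositive by [poincare]. *)
Lemma variance_decay : exists2 c, 0 < c &
  forall t : R, 0 <= t -> expR (c * t) * V t <= V 0.
Proof.
have [c c0 cP] := poincare n_gt0 q_gt0 G_sc.
exists c => // t t0.
pose W (t : R) := expR (c * t) * V t.
have -> : V 0 = W 0 by rewrite /W mulr0 expR0 mul1r.
have dV (s : R) : 0 < s ->
    is_derive s (1 : R) V (- dirichlet G q (fun i => y i s)).
  move=> s0; rewrite -(dirichletE (fun i => y i s) m qL).
  apply: is_derive_weighted_sum => i.
  have dy := (solution_ln i xs).2 _ s0.
  apply: is_derive_eq (is_deriveX 2 (is_deriveB dy (is_derive_cst m s 1))) _.
  by rewrite expr1 subr0 /GRing.scale/= -[RHS]mulrnAl -[in RHS]mulr_natl.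
have dW (s : R) : 0 < s -> is_derive s (1 : R) W
    (expR (c * s) * (c * V s - dirichlet G q (fun i => y i s))).
  move=> s0; have dc : is_derive s (1 : R) (fun r => c * r) c.
    by have := is_deriveZ c (is_derive_id s (1 : R)); rewrite [_ *: _]mulr1.
  have := is_deriveM (is_derive1_comp (is_derive_expR (c * s)) dc) (dV s s0).
  rewrite (_ : _ + _ = expR (c * s) *
    (c * V s - dirichlet G q (fun i => y i s)))//.
  by rewrite /GRing.scale/=; ring.
have cW : {within `[0, +oo[, continuous W}.
  move=> s; apply: cvgM.
    apply: (@continuous_subspaceT _ _ _ (fun r : R => expR (c * r))) s => r.
    apply: (@continuous_comp _ _ _ ( *%R c) expR); last exact: continuous_expR.
    exact: mulrl_continuous.
  move: s; apply: within_continuous_sum => i s; apply: cvgMl_tmp.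
  by apply: cvgM; apply: cvgB; [exact: (solution_ln i xs).1|exact: cvg_cst
                               |exact: (solution_ln i xs).1|exact: cvg_cst].
apply: (@ler0_derive1_nincry _ W 0) => // s; rewrite in_itv/= andbT => s0.
  by have [] := dW _ s0.
have [_] := dW _ s0; rewrite derive1E => ->.
rewrite mulr_ge0_le0 ?expR_ge0// subr_le0 cP//.
(* [poincare] requires [m] to be the weighted mean at time [s]; it is, because that mean is
   conserved. *)
rewrite solution_invariant ?(ltW s0)// /m divfK// gt_eqF//.
exact: sum_positive_vector.
Qed.

(** One term of [V] controls [y i], as [q_i (y_i - m)^2 <= V t]. The crude bound
    [c t <= expR (c * t)] then suffices: [V t] falls below [q_i e^2] once
    [t > V 0 / (c q_i e^2)]. *)
Lemma solution_ln_cvg i : y i t @[t --> +oo] --> m.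
Proof.
have [c c0 cV] := variance_decay.
apply/cvgrPdist_lt => e e0.
have qe : 0 < q i 0 * e ^+ 2 by rewrite mulr_gt0// exprn_gt0.
near=> t.
have t0 : 0 <= t by near: t; exact: nbhs_pinfty_ge.
rewrite -(@ltr_pXn2r _ 2) ?nnegrE// ?(ltW e0)// real_normK ?num_real//.
rewrite -sqrrN opprB -(ltr_pM2l (q_gt0 i)).
apply: (@le_lt_trans _ _ (V t)).
  rewrite /V (bigD1 i)//= lerDl sumr_ge0// => j _.
  by rewrite mulr_ge0 ?sqr_ge0// ltW.
rewrite ltNge; apply/negP => eV.
have : V 0 / (c * (q i 0 * e ^+ 2)) < t.
  by near: t; apply: nbhs_pinfty_gt; exact: num_real.
rewrite ltr_pdivrMr ?mulr_gt0// ltNge => /negP; apply.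
apply: le_trans (cV _ t0); rewrite mulrA [t * c]mulrC.
apply: ler_pM => //; [by rewrite mulr_ge0// ltW|exact: ltW|].
by rewrite (le_trans _ (expR_ge1Dx _))// lerDr.
Unshelve. all: by end_near. Qed.

Lemma solution_cvg : x t @[t --> +oo] --> (const_mx (expR m) : 'cV[R]_n).
Proof.
apply: cvg_mx => i j; rewrite mxE (ord1 j).
(* [expR] undoes [ln] only at positive arguments, and positivity of the state is known only for
   [0 <= t]; hence an eventual equality. *)
have xE : {near +oo, (fun t => expR (y i t)) =1 (fun t => x t i 0)}.
  near=> t; rewrite /y lnK// posrE.
  have [_ x_gt0 _ _] := xs; apply: x_gt0.
  by near: t; exact: nbhs_pinfty_ge.
apply: cvg_trans; first exact: near_eq_cvg xE.
apply: (@cvg_comp _ _ _ (y i) expR); first exact: solution_ln_cvg.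
exact: continuous_expR.
Unshelve. all: by end_near. Qed.

End Convergence.
End Trajectory.

(** * Consensus states as fixed points, and the value of the limit *)

Lemma fixed_point_const {R : realType} {n : nat} (G : wdigraph R n) (a : R) :
  0 < a -> fixed_point G (const_mx a).
Proof.
move=> a0; have pos : positive_vector (const_mx a : 'cV[R]_n).
  by move=> i; rewrite mxE.
split=> //; apply/colP => i; rewrite entropic_fieldE// [RHS]mxE.
rewrite /log_field big1 ?oppr0 ?mulr0// => j _.
by rewrite !mxE subrr mulr0.
Qed.

Theorem theorem2 (R : realType) (n : nat) (n_gt0 : (0 < n)%N)
    (G : wdigraph R n) (G_sc : strongly_connected G)
    (q : 'cV[R]_n) (q_gt0 : positive_vector q)
    (qL : q^T *m laplacian G = 0)
    (x0 : 'cV[R]_n) (x0_gt0 : positive_vector x0) :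
  let qhat : 'cV[R]_n := (norm1 q)^-1 *: q in
  let xbar : R := \prod_(i < n) (x0 i 0) `^ (qhat i 0) in
  [/\ fixed_point G (const_mx xbar),
      exists x : R -> 'cV[R]_n, solution G x0 x &
      forall x : R -> 'cV[R]_n, solution G x0 x ->
        x t @[t --> +oo] --> (const_mx xbar : 'cV[R]_n)].
Proof.
move=> qhat xbar; split.
- by apply/fixed_point_const/prodr_gt0 => i _; exact: powR_gt0.
- exact: solution_exists.
- move=> x xs; have := solution_cvg n_gt0 G_sc q_gt0 qL xs.
  congr (_ --> const_mx _).
  (* The exponential turns the weighted mean of logarithms into a product of powers; [norm1 q] is
     the plain sum of the entries because [q] is positive. *)
  rewrite mulr_suml expR_sum; apply: eq_bigr => i _.
  rewrite /powR gt_eqF// mxE; congr (expR _).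
  rewrite [LHS]mulrC mulrA; congr (_^-1 * _ * _).
  by apply: eq_bigr => j _; rewrite ger0_norm// ltW.
Qed.
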